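(* Let $\mathcal{D}$ be a dataset of $N$ points in $\mathbb{R}^d$, $\epsilon>0$, $\delta\in(0,1)$, and let $\mathcal{F}$ be a locality-sensitive hash family of functions $\mathbb{R}^d\to\{1,\dots,W\}$ with collision probability $k(\cdot,\cdot)$. Let $\mathcal{S}_{\mathcal{D}}\in\mathbb{Z}^{R\times W}$ be the $\epsilon$-differentially private RACE sketch with $R$ rows built from independent $l_1,\dots,l_R\in\mathcal{F}$ and i.i.d. $\mathrm{Lap}(R/\epsilon)$ noise added to every counter. For a query $\mathbf{q}\in\mathbb{R}^d$, let $X_r=\mathcal{S}_{\mathcal{D}}[r,l_r(\mathbf{q})]$, and let $\hat f_{\mathcal{D}}(\mathbf{q})$ be the median-of-means estimate obtained by splitting $X_1,\dots,X_R$ into $k=8\log(1/\delta)$ groups of $m=R/k$ consecutive values (assuming $k$ and $m$ are integers) and taking the median of the group means. Let $f_{\mathcal{D}}(\mathbf{q})=\sum_{\mathbf{x}\in\mathcal{D}}k(\mathbf{x},\mathbf{q})$ and $\tilde f_{\mathcal{D}}(\mathbf{q})=\sum_{\mathbf{x}\in\mathcal{D}}\sqrt{k(\mathbf{x},\mathbf{q})}$. Then with probability at least $1-\delta$, $$|\hat f_{\mathcal{D}}(\mathbf{q})-f_{\mathcal{D}}(\mathbf{q})|\le\left(\frac{\tilde f_{\mathcal{D}}^2(\mathbf{q})}{R}+\frac{2}{\epsilon^2}R\right)^{1/2}\sqrt{32\log 1/\delta}.$$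
   Context: A hash family $\mathcal{F}$ is locality-sensitive with collision probability $k(\cdot,\cdot)$ if for any $\mathbf{x},\mathbf{y}$, $l(\mathbf{x})=l(\mathbf{y})$ with probability $k(\mathbf{x},\mathbf{y})$ when $l$ is drawn uniformly at random from $\mathcal{F}$. The (non-private) RACE sketch has entries $\mathcal{S}_{\mathcal{D}}[r,j]=|\{\mathbf{x}\in\mathcal{D}:l_r(\mathbf{x})=j\}|$; the private sketch adds independent $\mathrm{Lap}(R/\epsilon)$ noise (zero-mean Laplace, scale $R/\epsilon$) to each entry. Probability is over the random choice of $l_1,\dots,l_R$ and the Laplace noise. *)

(* Defs.v *)
From HB Require Import structures.
From mathcomp Require Import all_boot all_order all_algebra.
From mathcomp Require Import all_classical all_reals all_analysis.

Set Implicit Arguments.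
Unset Strict Implicit.
Unset Printing Implicit Defensive.

Import Order.TTheory GRing.Theory Num.Theory.
Import numFieldNormedType.Exports.

Local Open Scope classical_set_scope.
Local Open Scope ring_scope.

HB.instance Definition _ (w : nat) := isPointed.Build 'I_w.+1 ord0.

(* Hash functions R^d -> {1,...,W} with W = w.+1 (the range cannot be empty;
   bucket j + 1 is encoded by j : 'I_w.+1), carrying the sigma-algebra generated
   by the evaluation events {h | h x = j}. *)
Definition hash_cylinder (R : realType) (d w : nat) :
    set (set ('rV[R]_d -> 'I_w.+1)) :=
  [set A | exists (x : 'rV[R]_d) (j : 'I_w.+1), A = [set h | h x = j]].

Definition hash_fun (R : realType) (d w : nat) :=
  g_sigma_algebraType (@hash_cylinder R d w).

HB.instance Definition _ (R : realType) (d w : nat) :=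
  Measurable.on (hash_fun R d w).

(* A family of hash functions together with the law of a random draw from it.
   For a finite family the uniform draw is the uniform law on the members; for
   infinite families (the usual case) there is no canonical uniform law, so the
   law is part of the data.  As the set of members need not be measurable, the
   last field says that its outer measure is 1. *)
Record hash_family (R : realType) (d w : nat) := HashFamily {
  hash_members : set (hash_fun R d w) ;
  hash_draw : probability (hash_fun R d w) R ;
  hash_drawP : forall A : set (hash_fun R d w),
    measurable A -> hash_members `<=` A -> hash_draw A = 1%E
}.

Definition locality_sensitive (R : realType) (d w : nat)
    (F : hash_family R d w) (k : 'rV[R]_d -> 'rV[R]_d -> R) : Prop :=
  forall x y : 'rV[R]_d,
    hash_draw F [set h : hash_fun R d w | h x = h y] = (k x y)%:E.

Definition race_sketch (R : realType) (d w n : nat)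
    (l : 'I_n -> hash_fun R d w) (D : seq 'rV[R]_d) : 'M[nat]_(n, w.+1) :=
  \matrix_(r < n, j < w.+1) count (fun x => l r x == j) D.

Definition private_race_sketch (R : realType) (d w n : nat)
    (l : 'I_n -> hash_fun R d w) (z : 'I_n -> 'I_w.+1 -> R)
    (D : seq 'rV[R]_d) : 'M[R]_(n, w.+1) :=
  \matrix_(r < n, j < w.+1) ((race_sketch l D r j)%:R + z r j).

Definition laplace_pdf (R : realType) (b x : R) : R :=
  expR (- (`|x| / b)) / (2 * b).

Definition laplace_law (R : realType) (b : R) (mu : set R -> \bar R) : Prop :=
  forall A : set R, measurable A ->
    mu A = (\int[lebesgue_measure]_(x in A) (laplace_pdf b x)%:E)%E.

Definition sigma_of (d d' : measure_display) (T : measurableType d)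
    (T' : measurableType d') (X : T -> T') : set (set T) :=
  preimage_set_system [set: T] X measurable.

Definition mutually_independent (d : measure_display) (T : measurableType d)
    (R : realType) (P : probability T R) (I : finType)
    (G : I -> set (set T)) : Prop :=
  forall (J : {set I}) (E : I -> set T),
    (forall i, i \in J -> G i (E i)) ->
    P (\bigcap_(i in [set` J]) E i) = (\prod_(i in J) P (E i))%E.

(* For an even number of values, the average of the two middle ones. *)
Definition median (R : realType) (s : seq R) : R :=
  let t := sort <=%R s in
  (t`_((size s).-1)./2 + t`_(size s)./2) / 2.

Definition mean (R : realType) (s : seq R) : R :=
  (\sum_(x <- s) x) / (size s)%:R.

Definition median_of_means (R : realType) (k m : nat) (s : seq R) : R :=
  median [seq mean g | g <- reshape (nseq k m) s].

Definition race_estimate (R : realType) (d w n : nat) (k m : nat)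
    (l : 'I_n -> hash_fun R d w) (S : 'M[R]_(n, w.+1)) (q : 'rV[R]_d) : R :=
  median_of_means k m [seq S r (l r q) | r <- enum 'I_n].

(* Main.v *)
(** The value [X r] read in row [r] is a collision count plus the Laplace noise
    of the bucket hit by the query.  Its mean is [f], because the noise is
    centred and independent of the hash function, and its variance is at most
    [ftilde ^ 2 + 2 (n / eps) ^ 2], because two points collide jointly with
    probability at most the geometric mean of their collision probabilities.
    By Chebyshev's inequality a group mean misses [f] by the stated bound with
    probability at most [1 / 4].  If the median misses it, so do at least half
    of the [k] groups, and these are independent events [B_i].  Expanding
    [3 ^ #{i | B_i} = prod_i (1 + 2 * 1_{B_i})] over subfamilies shows that its
    expectation is at most [(3 / 2) ^ k], so Markov's inequality bounds the
    failure probability by [(3 / 4) ^ (k / 2) <= exp (- k / 8) = delta].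

    The hypotheses only give the product rule for the generators [l r] and
    [Z r j]; independence of rows and of groups of rows follows from the
    pi-lambda theorem. *)

Require Import Defs.
From HB Require Import structures.
From mathcomp Require Import all_boot all_order all_algebra.
From mathcomp Require Import all_classical all_reals all_analysis.
From mathcomp Require Import measurable_realfun ring lra zify.

Import Order.TTheory GRing.Theory Num.Theory.
Import numFieldNormedType.Exports.

Local Open Scope classical_set_scope.
Local Open Scope ring_scope.

(** * Independence of blocks *)

Section independence.
Context {d : measure_display} {T : measurableType d} {R : realType}.
Context (P : probability T R).

(** For a fixed [B], the events obeying the product rule form a lambda-system that contains the
    pi-system [G]. Measurability is carried in the class because the complement and countable-union
    steps need it. *)
Lemma g_sigma_algebra_indep (G : set (set T)) (B : set T) :
  setI_closed G -> G `<=` measurable -> measurable B ->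
  (forall A, G A -> P (A `&` B) = (P A * P B)%E) ->
  forall A, <<s G >> A -> P (A `&` B) = (P A * P B)%E.
Proof.
move=> GI mG mB GB A sA.
suff : <<s G >> `<=` [set A | measurable A /\ P (A `&` B) = (P A * P B)%E].
  by move=> /(_ _ sA)[].
apply: lambda_system_subset => //; last by move=> C GC; split; [exact: mG|exact: GB].
apply/dynkin_lambda_system; split => /=.
- by rewrite setTI probability_setT mul1e.
- move=> C [mC CB]; split; first exact: measurableC.
  have PBfin : (P B < +oo)%E by rewrite ltey_eq fin_num_measure.
  transitivity (P B - P (C `&` B))%E.
    by rewrite setIC -setDE measureD// setIC.
  rewrite CB probability_setC//.
  by rewrite muleBl ?fin_num_measure ?mul1e// fin_num_adde_defr.
- move=> F tF mF.
  have mF' k : measurable (F k) by have [] := mF k.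
  split; first exact: bigcupT_measurable.
  rewrite setI_bigcupl.
  rewrite measure_bigcup//; last 2 first.
  + by move=> k _; exact: measurableI.
  + exact: trivIset_setIr.
  rewrite measure_bigcup//.
  have PB : P B = (fine (P B))%:E by rewrite fineK// fin_num_measure.
  rewrite muleC PB -nneseriesZl//; apply: eq_eseriesr => k _.
  by rewrite -PB muleC; exact: (mF k).2.
Qed.

(** The generators are replaced by their sigma-algebras one index at a time. Each replacement
    applies the previous lemma with [B] the intersection of the events at the other indices. *)
Lemma mutually_independent_g_sigma (I : finType) (G : I -> set (set T)) :
  (forall i, setI_closed (G i)) -> (forall i, G i `<=` measurable) ->
  mutually_independent P G ->
  mutually_independent P (fun i => <<s G i >>).
Proof.
move=> GI mG iG.
have msG i A : <<s G i >> A -> measurable A.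
  by apply: smallest_sub; [exact: sigma_algebra_measurable|exact: mG].
(* Intermediate families: the indices in [s] are already upgraded, the others are not. Induction on
   [s] then ends at the list of all indices. *)
suff H (s : seq I) : mutually_independent P
    (fun i => if i \in s then <<s G i >> else G i).
  move=> J E EJ; apply: (H (enum I)) => i iJ; rewrite mem_enum; exact: EJ.
elim: s => [|i0 s ih] J E EJ; first by apply: iG => i /EJ.
have EJ' i : i \in J -> i != i0 -> (if i \in s then <<s G i >> else G i) (E i).
  by move=> iJ /negPf ii0; have := EJ _ iJ; rewrite inE ii0.
have [i0J|i0J] := boolP (i0 \in J); last first.
  apply: ih => i iJ; apply: EJ' => //.
  by apply: contraNneq i0J => <-.
rewrite (big_setD1 i0)//=.
have JD (E' : I -> set T) : \bigcap_(i in [set` J]) E' i =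
    E' i0 `&` \bigcap_(i in [set` (J :\ i0)%SET]) E' i.
  apply/seteqP; split => [t Et|t [Et0 Et] i /= iJ].
    by split => [|i /=]; [exact: Et|rewrite !inE => /andP[_]; exact: Et].
  by have [->//|ii0] := eqVneq i i0; apply: Et; rewrite /= !inE ii0.
rewrite JD -ih; last first.
  by move=> i; rewrite !inE => /andP[? ?]; exact: EJ'.
apply: (@g_sigma_algebra_indep (G i0)) => //.
- apply: fin_bigcap_measurable => //.
  move=> i /=; rewrite !inE => /andP[ii0 iJ].
  by have := EJ' _ iJ ii0; case: ifP => _; [exact: msG|exact: mG].
- move=> A GA.
  (* [E'] is [E] with a generator put at [i0], so the induction hypothesis covers it on both [J] and
     [J :\ i0]. *)
  pose E' i := if i == i0 then A else E i.
  have E'D : \bigcap_(i in [set` (J :\ i0)%SET]) E i =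
             \bigcap_(i in [set` (J :\ i0)%SET]) E' i.
    by apply: eq_bigcapr => i /=; rewrite !inE /E' => /andP[/negPf ->].
  rewrite E'D -[A in A `&` _](_ : E' i0 = A); last by rewrite /E' eqxx.
  rewrite -JD ih ?(big_setD1 i0 i0J)/=; last first.
    move=> i iJ; rewrite /E'; case: eqVneq => [->|]; last exact: EJ'.
    by case: ifP => // _; exact: sub_sigma_algebra.
  rewrite ih ?{1}/E' ?eqxx//.
  by move=> i; rewrite !inE /E' => /andP[/[dup] ii0 /negPf ->] ?; exact: EJ'.
- by have := EJ _ i0J; rewrite inE eqxx.
Qed.

(** One event per member of the block, intersected. Unlike the union of the [G i], this generating
    system is stable under intersection when each [G i] is, as the pi-lambda argument requires. *)
Definition block_system (I K : finType) (f : I -> K) (G : I -> set (set T))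
    (k : K) : set (set T) :=
  [set A | exists2 E : I -> set T, (forall i, G i (E i)) &
     A = \bigcap_(i in [set i | f i = k]) E i].

(** On the generating pi-systems, an intersection over blocks flattens to one over their members.
    The product rule for [G] applies there, and the product is regrouped by block. *)
Lemma mutually_independent_blocks (I K : finType) (f : I -> K)
    (G : I -> set (set T)) :
  (forall i, setI_closed (G i)) -> (forall i, G i `<=` measurable) ->
  mutually_independent P G ->
  mutually_independent P (fun k => <<s block_system I K f G k >>).
Proof.
move=> GI mG iG; apply: mutually_independent_g_sigma.
- move=> k _ _ [E GE ->] [E' GE' ->]; exists (fun i => E i `&` E' i).
    by move=> i; exact: GI.
  by rewrite bigcapI.
- move=> k _ [E GE ->]; apply: fin_bigcap_measurable => //.
  by move=> i _; exact: mG.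
move=> J A AJ.
have /choice[E EA] : forall k, exists E : I -> set T, k \in J ->
    (forall i, G i (E i)) /\ A k = \bigcap_(i in [set i | f i = k]) E i.
  move=> k.
  have [/AJ[Ek ? ?]|kJ] := boolP (k \in J); first by exists Ek.
  by exists (fun=> setT).
pose J' := [set i | f i \in J]%SET.
transitivity (P (\bigcap_(i in [set` J']) E (f i) i)).
  congr (P _); apply/seteqP; split => [t At i|t Et k /= kJ].
    rewrite /= inE => fiJ; have := At _ fiJ.
    by rewrite (EA _ fiJ).2; exact.
  by rewrite (EA _ kJ).2 => i /= fik; rewrite -fik; apply: Et; rewrite /= inE fik.
rewrite iG; last by move=> i; rewrite inE => fiJ; exact: (EA _ fiJ).1.
rewrite (partition_big f (mem J))/=; last by move=> i; rewrite inE.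
apply: eq_bigr => k kJ; rewrite (EA _ kJ).2.
rewrite [X in P X](_ : _ = \bigcap_(i in [set` [set i | f i == k]%SET]) E k i).
  rewrite iG; last by move=> i _; exact: (EA _ kJ).1.
  apply: eq_big => [i|i]; rewrite !inE; last by move=> /andP[_ /eqP ->].
  by case: eqVneq => [->|]; rewrite ?kJ ?andbF.
apply/seteqP; split => t Et i /=; rewrite ?inE => fi; apply: Et => /=.
  by apply/eqP.
by rewrite inE; exact/eqP.
Qed.

(** The other members of the block are padded with the full set. *)
Lemma sub_block_system (I K : finType) (f : I -> K) (G : I -> set (set T)) i A :
  (forall j, G j setT) -> G i A -> block_system I K f G (f i) A.
Proof.
move=> GT GA; exists (fun j => if j == i then A else setT).
  by move=> j; case: eqVneq => [->|].
apply/seteqP; split => [t At j _|t At]; first by case: eqP.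
by have := At i erefl; rewrite eqxx.
Qed.

Lemma mutually_independent2 (I : finType) (G : I -> set (set T)) i j A B :
  mutually_independent P G -> i != j -> G i A -> G j B ->
  P (A `&` B) = (P A * P B)%E.
Proof.
move=> iG ij GA GB; pose E x := if x == i then A else B.
have ji : (j == i) = false by rewrite eq_sym (negPf ij).
have := iG [set i; j]%SET E; rewrite big_setU1 ?inE//= big_set1 /E eqxx ji => <-.
- congr (P _); apply/seteqP; split => [t [At Bt] x|t ABt].
    by rewrite /= !inE => /orP[] /eqP ->; rewrite ?eqxx ?ji.
  split; first by have := ABt i; rewrite /= !inE !eqxx; exact.
  by have := ABt j; rewrite /= !inE ji eqxx; exact.
- by move=> x; rewrite !inE => /orP[] /eqP ->; rewrite ?eqxx ?ji.
Qed.

(** The product rule on rectangles identifies the joint law of [U] and [V] with the product of their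
    laws. Tonelli gives integrability of the product, and Fubini factors its expectation. *)
Lemma expectation_indep_prod (U V : T -> R) :
  U \in Lfun P 1 -> V \in Lfun P 1 ->
  (forall A B, measurable A -> measurable B ->
    P (U @^-1` A `&` V @^-1` B) = (P (U @^-1` A) * P (V @^-1` B))%E) ->
  U \* V \in Lfun P 1 /\ ('E_P[U \* V] = 'E_P[U] * 'E_P[V])%E.
Proof.
move=> /Lfun1_integrable iU /Lfun1_integrable iV indUV.
have mU : measurable_fun setT U by have /integrableP[/measurable_EFinP] := iU.
have mV : measurable_fun setT V by have /integrableP[/measurable_EFinP] := iV.
pose X : {RV P >-> R} := mfun_Sub (mem_set mU).
pose Y : {RV P >-> R} := mfun_Sub (mem_set mV).
pose W : {RV P >-> (R * R)%type} := mfun_Sub (mem_set (measurable_fun_pair mU mV)).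
pose f (z : R * R) : \bar R := (z.1 * z.2)%:E.
have mf : measurable_fun setT f.
  apply/measurable_EFinP; apply: measurable_funM; [exact: measurable_fst|exact: measurable_snd].
have WE A : measurable A -> (distribution P X \x distribution P Y)%E A = distribution P W A.
  by apply: product_measure_unique => B C mB mC; exact: indUV.
have idE : measurable_fun [set: R] (EFin : R -> \bar R) by exact/measurable_EFinP.
have nidE : measurable_fun [set: R] (fun x : R => `|x|%:E) by exact: measurableT_comp.
have distr_int (Z : {RV P >-> R}) : P.-integrable setT (EFin \o Z) ->
    (distribution P Z).-integrable setT (EFin : R -> \bar R).
  move=> /integrableP[_ Zoo]; apply/integrableP; split => //.
  by rewrite ge0_integral_distribution//=; exact: measurableT_comp.
have iX := distr_int X iU; have iY := distr_int Y iV.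
have iprod : (distribution P X \x distribution P Y)%E.-integrable setT f.
  apply/integrable12ltyP => //.
  under eq_integral do under eq_integral do rewrite /f/= normrM EFinM.
  under eq_integral do rewrite ge0_integralZl//.
  rewrite ge0_integralZr//; last exact: integral_ge0.
  by rewrite lte_mul_pinfty ?integral_ge0 ?ge0_fin_numE ?integral_ge0//;
    [have /integrableP[] := iX|have /integrableP[] := iY].
have iW : P.-integrable setT (f \o W).
  apply/integrableP; split; first exact: measurableT_comp.
  have /integrableP[_] := iprod; rewrite (eq_measure_integral (distribution P W)); last first.
    by move=> A mA _; exact: WE.
  by rewrite ge0_integral_distribution//; exact: measurableT_comp.
split; first exact/Lfun1_integrable.
have EE (Z : {RV P >-> R}) : P.-integrable setT (EFin \o Z) ->
    (\int[distribution P Z]_x x%:E = 'E_P[Z])%E.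
  by move=> iZ; rewrite integral_distribution// unlock.
rewrite -(EE X iU) -(EE Y iV) unlock.
transitivity (\int[distribution P X \x distribution P Y]_z f z)%E.
  transitivity (\int[distribution P W]_z f z)%E; first by rewrite integral_distribution.
  by apply: eq_measure_integral => A mA _; apply: esym; exact: WE.
rewrite -integral12_prod_meas1//.
have FE x : fubini_F (distribution P Y) f x =
    (x%:E * \int[distribution P Y]_y y%:E)%E.
  rewrite /fubini_F; under eq_integral do rewrite /f/= EFinM.
  by rewrite integralZl.
under eq_integral do rewrite FE.
have -> : (\int[distribution P Y]_y y%:E = (fine (\int[distribution P Y]_y y%:E))%:E)%E.
  by rewrite fineK//; exact: integrable_fin_num.
by rewrite integralZr.
Qed.

End independence.

(** * Moments of the Laplace law *)

Lemma laplace_pdf_ge0 (R : realType) (b x : R) : 0 < b -> 0 <= laplace_pdf b x.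
Proof. by move=> b0; rewrite divr_ge0 ?expR_ge0 ?mulr_ge0 ?ltW. Qed.

Lemma laplace_pdf_sym (R : realType) (b x : R) :
  laplace_pdf b (- x) = laplace_pdf b x.
Proof. by rewrite /laplace_pdf normrN. Qed.

Lemma continuous_laplace_pdf (R : realType) (b : R) :
  continuous (laplace_pdf b).
Proof.
move=> x; apply: cvgMr_tmp; apply: continuous_comp; last exact: continuous_expR.
by apply: cvgN; apply: cvgMr_tmp; exact: norm_continuous.
Qed.

Lemma measurable_laplace_pdf (R : realType) (b : R) :
  measurable_fun [set: R] (laplace_pdf b).
Proof. apply: continuous_measurable_fun; exact: continuous_laplace_pdf. Qed.

(** The density [g] agrees almost everywhere with the Radon-Nikodym derivative, both having the same
    integral over every measurable set. Change of variables for that derivative then transfers to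
    [g]. *)
Lemma ge0_integral_density {d : measure_display} {T : measurableType d}
    {R : realType} (mu : {sigma_finite_measure set T -> \bar R})
    (nu : probability T R) (g f : T -> R) :
  measurable_fun [set: T] g -> (forall x, 0 <= g x) ->
  (forall A, measurable A -> nu A = (\int[mu]_(x in A) (g x)%:E)%E) ->
  measurable_fun [set: T] f -> (forall x, 0 <= f x) ->
  (\int[nu]_x (f x)%:E = \int[mu]_x (f x * g x)%:E)%E.
Proof.
move=> mg g0 nuE mf f0.
have ig : mu.-integrable [set: T] (EFin \o g).
  apply/integrableP; split; first exact/measurable_EFinP.
  under eq_integral do rewrite /= ger0_norm//.
  by rewrite -nuE// probability_setT ltry.
have numu : nu `<< mu.
  apply/null_content_dominatesP => A mA muA0; rewrite nuE//.
  by apply: null_set_integral => //; exact: measurable_funTS (measurable_int _ ig).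
rewrite -(Radon_Nikodym_SigmaFinite.change_of_variables numu)//;
  last exact/measurable_EFinP.
have iRN := Radon_Nikodym_SigmaFinite.f_integrable numu.
under [RHS]eq_integral do rewrite EFinM.
apply: ae_eq_integral => //.
- by apply: emeasurable_funM; [exact/measurable_EFinP|exact: (measurable_int _ iRN)].
- by apply: emeasurable_funM; exact/measurable_EFinP.
- apply: ae_eqe_mul2l; apply: integral_ae_eq => //.
    exact/measurable_EFinP.
  by move=> E _ mE; rewrite -(Radon_Nikodym_SigmaFinite.f_integral numu)// -nuE.
Qed.

Lemma ge0_expectation_density {d d' : measure_display} {T : measurableType d}
    {T' : measurableType d'} {R : realType} (P : probability T R)
    (mu : {sigma_finite_measure set T' -> \bar R}) (h : T -> T') (g f : T' -> R) :
  measurable_fun [set: T] h ->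
  measurable_fun [set: T'] g -> (forall x, 0 <= g x) ->
  (forall A, measurable A -> P (h @^-1` A) = (\int[mu]_(x in A) (g x)%:E)%E) ->
  measurable_fun [set: T'] f -> (forall x, 0 <= f x) ->
  (\int[P]_t (f (h t))%:E = \int[mu]_x (f x * g x)%:E)%E.
Proof.
move=> mh mg g0 hE mf f0.
pose H : {RV P >-> T'} := mfun_Sub (mem_set mh).
rewrite -(@ge0_integral_density _ _ _ mu (distribution P H))//.
by rewrite ge0_integral_distribution//; exact/measurable_EFinP.
Qed.

(** The degree [n.+1] term of the exponential series bounds [expR (x / b)] from below, so the
    expression is at most [c / x] for positive [x]. *)
Lemma cvg_exprM_expRN {R : realType} (b : R) (n : nat) : 0 < b ->
  (x ^+ n * expR (- (x / b))) @[x --> +oo] --> (0 : R).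
Proof.
move=> b0; pose c := n.+1`!%:R * b ^+ n.+1.
have c0 : 0 < c by rewrite mulr_gt0 ?exprn_gt0// ltr0n fact_gt0.
apply/cvgrPdist_le => e e0; near=> x.
have x0 : 0 < x by near: x; exact: nbhs_pinfty_gt.
have cx : c / e <= x by near: x; apply: nbhs_pinfty_ge; rewrite num_real.
rewrite sub0r normrN ger0_norm ?mulr_ge0 ?expR_ge0 ?exprn_ge0 ?(ltW x0)//.
rewrite expRN ler_pdivrMr ?expR_gt0//.
have /(le_trans _) : (x / b) ^+ n.+1 / n.+1`!%:R <= expR (x / b).
  have xb0 : 0 <= x / b by rewrite ltW// divr_gt0.
  by apply: le_trans (expR_ge1Dxn n xb0); rewrite lerDr.
rewrite -ler_pdivrMl//; apply.
have -> : (x / b) ^+ n.+1 / n.+1`!%:R = x ^+ n * x / c.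
  by rewrite expr_div_n exprSr /c; field; rewrite expf_neq0 ?gt_eqF// ltr0n fact_gt0.
rewrite ler_pdivlMr// mulrAC mulrC ler_wpM2l ?exprn_ge0 ?(ltW x0)//.
Unshelve. all: by end_near. Qed.

Lemma laplace_second_moment (R : realType) (b : R) : 0 < b ->
  (\int[lebesgue_measure]_x (x ^+ 2 * laplace_pdf b x)%:E = (2 * b ^+ 2)%:E)%E.
Proof.
move=> b0.
have cf : continuous (fun x : R => x ^+ 2 * laplace_pdf b x).
  by move=> x; apply: cvgM; [exact: exprn_continuous|exact: continuous_laplace_pdf].
rewrite ge0_symfun_integralT//; last 2 first.
- by move=> x; rewrite mulr_ge0 ?sqr_ge0 ?laplace_pdf_ge0.
- by move=> x /=; rewrite sqrrN laplace_pdf_sym.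
rewrite -set_itvcy.
(* A primitive of the integrand on the positive half-line. It rises from [- b ^+ 2] at 0 to 0 at
   infinity, and evenness doubles the resulting [b ^+ 2]. *)
pose F (x : R) := - ((x ^+ 2 / 2 + b * x + b ^+ 2) * expR (- (x / b))).
rewrite (@ge0_continuous_FTC2y _ _ F _ 0)//.
- have -> : F 0 = - b ^+ 2.
    by rewrite /F expr0n/= !(mul0r, mulr0, oppr0, add0r, expR0) mulr1.
  by rewrite sub0e EFinN oppeK.
- by move=> x _; rewrite mulr_ge0 ?sqr_ge0 ?laplace_pdf_ge0.
- exact: continuous_subspaceT.
- rewrite -oppr0; apply: cvgN.
  rewrite [X in X @ _ --> _](_ : _ = fun x => 2^-1 * (x ^+ 2 * expR (- (x / b))) +
     b * (x ^+ 1 * expR (- (x / b))) + b ^+ 2 * (x ^+ 0 * expR (- (x / b)))); last first.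
    by apply/funext => x; rewrite expr1 expr0; ring.
  rewrite -[X in _ --> X](_ : 2^-1 * 0 + b * 0 + b ^+ 2 * 0 = 0); last by rewrite !mulr0 !addr0.
  by apply: cvgD; [apply: cvgD|]; apply: cvgMl_tmp; exact: cvg_exprM_expRN.
- apply: cvg_at_right_filter; apply: differentiable_continuous.
  apply/derivable1_diffP; exact: ex_derive.
- move=> x; rewrite in_itv/= andbT => x0.
  rewrite derive1E derive_val /laplace_pdf gtr0_norm//.
  rewrite /GRing.scale/=.
  by field; rewrite gt_eqF.
Qed.

(** Since [f] vanishes on the nonpositive half-line, both sides reduce to half-line integrals
    related by substitution. This serves to compare the positive and negative parts of a Laplace
    variable. *)
Lemma ge0_integralT_oppr {R : realType} (f : R -> R) :
  continuous f -> (forall x, 0 <= f x) -> (forall x, x <= 0 -> f x = 0) ->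
  (\int[lebesgue_measure]_x (f (- x))%:E = \int[lebesgue_measure]_x (f x)%:E)%E.
Proof.
move=> cf f0 fN.
transitivity (\int[lebesgue_measure]_(x in `]-oo, (- 0)%R]) (f (- x))%:E)%E.
  rewrite [RHS]integral_mkcond; apply: eq_integral => x _.
  rewrite patchE; case: ifPn => //; rewrite notin_setE/= in_itv/= oppr0 => /negP.
  by rewrite -ltNge => x0; rewrite fN// oppr_le0 ltW.
have cfN : continuous (f \o -%R).
  by move=> x; apply: continuous_comp; [exact: opp_continuous|exact: cf].
rewrite (ge0_integration_by_substitutionNy (continuous_subspaceT cfN))//;
  last by move=> x _; exact: f0.
rewrite integral_mkcond; apply: eq_integral => x _.
rewrite patchE /= opprK; case: ifPn => //; rewrite notin_setE/= in_itv/= andbT => /negP.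
by rewrite -ltNge => x0; rewrite fN// ltW.
Qed.

Lemma Lfun2_sqr_lty {d : measure_display} {T : measurableType d} {R : realType}
    (mu : {measure set T -> \bar R}) (f : T -> R) :
  measurable_fun [set: T] f -> (\int[mu]_x (f x ^+ 2)%:E < +oo)%E ->
  f \in Lfun mu 2%:E.
Proof.
move=> mf foo; rewrite inE; apply/andP; split; rewrite inE//=.
rewrite /finite_norm unlock poweR_lty//.
under eq_integral do rewrite /= powR_mulrn// real_normK ?num_real//.
by [].
Qed.

Section laplace_moments.
Context {d : measure_display} {T : measurableType d} {R : realType}.
Context (P : probability T R) (Z : {RV P >-> R}) (b : R).
Hypotheses (b0 : 0 < b) (lawZ : laplace_law b (distribution P Z)).

Lemma ge0_expectation_laplace (f : R -> R) :
  measurable_fun [set: R] f -> (forall x, 0 <= f x) ->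
  (\int[P]_t (f (Z t))%:E =
   \int[lebesgue_measure]_x (f x * laplace_pdf b x)%:E)%E.
Proof.
move=> mf f0.
rewrite (@ge0_expectation_density _ _ _ _ _ P lebesgue_measure Z (laplace_pdf b))//.
- exact: (measurable_funPT Z).
- exact: measurable_laplace_pdf.
- by move=> x; exact: laplace_pdf_ge0.
Qed.

Lemma laplace_expectation_sqr : (\int[P]_t (Z t ^+ 2)%:E = (2 * b ^+ 2)%:E)%E.
Proof.
rewrite (ge0_expectation_laplace (fun x => x ^+ 2)).
- exact: laplace_second_moment.
- exact: exprn_measurable.
- by move=> x; exact: sqr_ge0.
Qed.

Lemma laplace_Lfun2 : (Z : T -> R) \in Lfun P 2%:E.
Proof. by apply: Lfun2_sqr_lty => //; rewrite laplace_expectation_sqr ltry. Qed.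

(** By evenness of the density the positive and negative parts have equal integrals. These are
    finite because [Z] is square-integrable, so their difference is 0. *)
Lemma laplace_expectation : ('E_P[Z] = 0)%E.
Proof.
have mpos : measurable_fun [set: R] (fun x : R => Num.max x 0).
  exact: measurable_maxr.
have iZ : P.-integrable [set: T] (EFin \o Z).
  by apply/Lfun1_integrable/Lfun_subset12; [exact: fin_num_measure|exact: laplace_Lfun2].
have posE : (\int[P]_t (EFin \o Z)^\+ t =
    \int[lebesgue_measure]_x (Num.max x 0 * laplace_pdf b x)%:E)%E.
  rewrite -(ge0_expectation_laplace (fun x => Num.max x 0))//.
    by apply: eq_integral => t _; rewrite funeposE/= EFin_max.
  by move=> x; rewrite le_max lexx orbT.
have negE : (\int[P]_t (EFin \o Z)^\- t =
    \int[lebesgue_measure]_x (Num.max (- x) 0 * laplace_pdf b (- x))%:E)%E.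
  under [RHS]eq_integral do rewrite laplace_pdf_sym.
  rewrite -(ge0_expectation_laplace (fun x => Num.max (- x) 0))//.
  - by apply: eq_integral => t _; rewrite funenegE/= EFin_max EFinN.
  - exact: measurableT_comp mpos (@oppr_measurable _ _).
  - by move=> x; rewrite le_max lexx orbT.
rewrite unlock integralE negE.
rewrite (@ge0_integralT_oppr _ (fun x => Num.max x 0 * laplace_pdf b x)) -?posE.
- by rewrite subee// integrable_pos_fin_num.
- move=> x; apply: cvgM; last exact: continuous_laplace_pdf.
  by apply: continuous_max; [exact: cvg_id|exact: cvg_cst].
- by move=> x; rewrite mulr_ge0 ?laplace_pdf_ge0// le_max lexx orbT.
- by move=> x x0; rewrite max_r// mul0r.
Qed.

End laplace_moments.

(** * Medians and majorities *)

(** As [p] is downward closed, the sorted entries satisfying it form an initial segment of length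
    [count p s]. *)
Lemma nth_sort_count {R : realType} (p : pred R) (s : seq R) (i : nat) :
  (forall x y, x <= y -> p y -> p x) -> (i < size s)%N ->
  p (sort <=%R s)`_i = (i < count p s)%N.
Proof.
move=> pdown; rewrite -(size_sort <=%R s) -(count_sort <=%R) => ilt.
have := sort_le_sorted s; set t := sort _ s in ilt * => tsorted.
have tle j1 j2 : (j1 <= j2)%N -> (j2 < size t)%N -> t`_j1 <= t`_j2.
  by move=> j12 j2t; apply: le_sorted_leq_nth => //; rewrite inE (leq_ltn_trans j12).
have count_iota : count p t = count (fun j => p t`_j) (iota 0 (size t)).
  by rewrite -{1}(mkseq_nth 0 t) /mkseq count_map.
(* The positions are split just after [i]. If [p] holds at [i], it holds on the whole first part;
   otherwise it fails on the second part and at the last position of the first. *)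
rewrite count_iota -[size t](subnKC ilt) iotaD count_cat.
apply/idP/idP => [pti|].
- rewrite [X in (X + _)%N](_ : _ = i.+1) ?leq_addr//.
  rewrite -[RHS](size_iota 0); apply/eqP; rewrite -all_count; apply/allP => j.
  by rewrite mem_iota add0n => /andP[_ ji]; apply: pdown pti; exact: tle.
- apply: contraLR => npti; rewrite -leqNgt.
  rewrite [X in (_ + X)%N](_ : _ = 0%N); last first.
    apply/eqP; rewrite -leqn0 leqNgt -has_count; apply/hasPn => j.
    rewrite mem_iota add0n subnKC// => /andP[ij jt].
    by apply: contra npti; apply: pdown; apply: tle => //; exact: ltnW.
  rewrite addn0 -addn1 iotaD count_cat /= add0n (negPf npti) !addn0.
  by rewrite (leq_trans (count_size _ _))// size_iota.
Qed.

(** The median lies between the middle values [a <= b]. If it is too low, so is [a] and everything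
    sorted before it; if too high, so is [b] and everything after it. Either way at least half of
    the entries are far. *)
Lemma median_far_count {R : realType} (s : seq R) (f t : R) : (0 < size s)%N ->
  t < `|median s - f| -> (size s <= (count (fun x => t <= `|x - f|)%R s).*2)%N.
Proof.
move=> s0; rewrite /median; set u := sort _ s; set a := u`_ _; set b := u`_ _.
have hlt : ((size s)./2 < size s)%N by rewrite ltn_half_double -addnn -{1}[size s]addn0 ltn_add2l.
have h'lt : ((size s).-1./2 < size s)%N by rewrite (leq_ltn_trans _ hlt)// half_leq// leq_pred.
have ab : a <= b.
  by apply: le_sorted_leq_nth; rewrite ?sort_le_sorted// ?inE ?size_sort// half_leq// leq_pred.
rewrite ltNge ler_distl negb_and -!ltNge => /orP[lo|hi].
- have af : a < f - t by lra.
  have := @nth_sort_count _ (fun x => x < f - t) s (size s).-1./2.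
  rewrite -/u -/a af => /(_ _ h'lt) H.
  have /esym : true = ((size s).-1./2 < count (fun x => x < f - t)%R s)%N.
    by apply: H => x y; exact: le_lt_trans.
  have sub : (count (fun x => x < f - t)%R s <= count (fun x => t <= `|x - f|)%R s)%N.
    apply: sub_count => x /= xf.
    by rewrite distrC (le_trans _ (ler_norm _))//; lra.
  move=> /leq_trans/(_ sub); rewrite -leq_double; apply: leq_trans.
  rewrite doubleS -[X in (X <= _)%N](prednK s0) -[X in (X.+1 <= _)%N]odd_double_half.
  by rewrite -addSn -[_.+2]/(2 + _)%N leq_add2r; case: odd.
- have bf : f + t < b by lra.
  have := @nth_sort_count _ (fun x => x <= f + t) s (size s)./2.
  rewrite -/u -/b leNgt bf /= => /(_ _ hlt) H.
  have /esym/negbT : false = ((size s)./2 < count (fun x => x <= f + t)%R s)%N.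
    by apply: H => x y; exact: le_trans.
  rewrite -leqNgt => cle.
  have sub : (count (predC (fun x => x <= f + t)%R) s <= count (fun x => t <= `|x - f|)%R s)%N.
    apply: sub_count => x /=; rewrite -ltNge => xf.
    by rewrite (le_trans _ (ler_norm _))//; lra.
  move: cle sub (count_predC (fun x => x <= f + t) s).
  move: (count _ s) (count _ s) (count _ s) (size s) => x y z n.
  lia.
Qed.

Lemma reshape_nseqE {A : Type} (x0 : A) (k m : nat) (s : seq A) :
  size s = (k * m)%N ->
  reshape (nseq k m) s =
  [seq [seq nth x0 s j | j <- iota (i * m) m] | i <- iota 0 k].
Proof.
elim: k s => [|k ih] s /=; first by [].
rewrite mulSn => ss; congr cons.
  by rewrite mul0n map_nth_iota0// ss leq_addr.
rewrite ih; last by rewrite size_drop ss addKn.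
rewrite -[1%N]/(1 + 0)%N iotaDl -map_comp; apply: eq_map => i /=.
rewrite add1n mulSn iotaDl -map_comp; apply: eq_map => j /=.
by rewrite nth_drop.
Qed.

(** Removing the power [k] and squaring leaves [3 / 4 <= expR (- (1 / 4))], which is
    [1 + x <= expR x] at [x = - (1 / 4)]. *)
Lemma expR_chernoff {R : realType} (k : nat) :
  (Num.sqrt 3 / 2 : R) ^+ k <= expR (- (k%:R / 8)).
Proof.
rewrite (_ : - (k%:R / 8) = k%:R * (- (1 / 8))); last by ring.
rewrite expRM_natl lerXn2r ?nnegrE ?expR_ge0 ?divr_ge0 ?sqrtr_ge0//.
rewrite -(@ler_sqr R) ?nnegrE ?expR_ge0 ?divr_ge0 ?sqrtr_ge0//.
rewrite expr_div_n sqr_sqrtr// -expRM_natl.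
by apply: le_trans (expR_ge1Dx _); lra.
Qed.

Section majority.
Context {d : measure_display} {T : measurableType d} {R : realType}.
Context (P : probability T R) (k : nat) (B : 'I_k -> set T).

(** The event is a finite union, over index sets of size at least [n], of finite intersections. *)
Lemma measurable_card_ge (n : nat) : (forall i, measurable (B i)) ->
  measurable [set t | (n <= #|[set i | t \in B i]%SET|)%N].
Proof.
move=> mB.
rewrite (_ : [set t | _] = \bigcup_(J in [set J : {set 'I_k} | (n <= #|J|)%N])
    \bigcap_(i in [set` J]) B i); last first.
  apply/seteqP; split => [t /= nt|t [J /= nJ Jt] /=].
    exists [set i | t \in B i]%SET => //= i /=.
    by rewrite inE => /set_mem.
  rewrite (leq_trans nJ)// subset_leq_card//; apply/fintype.subsetP => i iJ.
  by rewrite inE; apply/mem_set; exact: Jt.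
apply: fin_bigcup_measurable => // J _.
by apply: fin_bigcap_measurable => // i _; exact: mB.
Qed.

Lemma measurable_majority : (forall i, measurable (B i)) ->
  measurable [set t | (k <= (#|[set i | t \in B i]%SET|).*2)%N].
Proof.
move=> mB.
rewrite (_ : mkset _ = [set t | (uphalf k <= #|[set i | t \in B i]%SET|)%N]).
  exact: measurable_card_ge.
by apply/seteqP; split => t /=; rewrite leq_uphalf_double.
Qed.

Lemma independent_majority :
  (forall i, measurable (B i)) ->
  (forall J : {set 'I_k},
     P (\bigcap_(i in [set` J]) B i) = (\prod_(i in J) P (B i))%E) ->
  (forall i, P (B i) <= (1 / 4)%:E)%E ->
  (P [set t | (k <= (#|[set i | t \in B i]%SET|).*2)%N] <= (expR (- (k%:R / 8)))%:E)%E.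
Proof.
move=> mB indB PB.
pose A := [set t | (k <= (#|[set i | t \in B i]%SET|).*2)%N].
have mA : measurable A by exact: measurable_majority.
(* The square root of 3 expresses [3 ^ (k / 2)] as [c ^+ k] for odd [k] too. The base 3 is the [x]
   minimising [(3 + x) / (4 * sqrt x)], the rate that Markov's inequality gives for base [x]. *)
pose c : R := Num.sqrt 3.
have c0 : 0 < c by rewrite sqrtr_gt0.
have cc : c ^+ 2 = 3 by rewrite sqr_sqrtr.
have c1 : 1 <= c by rewrite -(@ler_sqr R) ?nnegrE ?ltW// cc; lra.
have H : ((c ^+ k)%:E * P A <= ((3 / 2) ^+ k)%:E)%E.
  (* Used twice: forwards with indicators, backwards with probabilities. *)
  have expand (x : 'I_k -> R) : \prod_i (1 + 2 * x i) =
      \sum_(J : {set 'I_k}) 2 ^+ #|J| * \prod_(i in J) x i.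
    under eq_bigr do rewrite addrC.
    rewrite bigA_distr; apply: eq_big => // J _.
    rewrite (bigID (mem J))/= [X in _ * X]big1 ?mulr1; last by move=> i /negPf ->.
    under eq_bigr => i -> do [].
    by rewrite big_split/= prodr_const.
  have ind t (J : {set 'I_k}) : \1_(\bigcap_(i in [set` J]) B i) t =
      \prod_(i in J) \1_(B i) t :> R.
    have [Jt|Jt] := pselect ((\bigcap_(i in [set` J]) B i) t).
      rewrite indicE mem_set//= big1// => i iJ; by rewrite indicE mem_set//; exact: Jt.
    rewrite indicE memNset//=.
    have [i iJ iB] : exists2 i, i \in J & ~ B i t.
      by apply: contra_notP Jt => /forall2NP Jt i iJ; have [/(_ iJ)|/contrapT] := Jt i.
    by rewrite (bigD1 i)//= indicE memNset// mul0r.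
  have sumE t : \sum_(J : {set 'I_k}) 2 ^+ #|J| * \1_(\bigcap_(i in [set` J]) B i) t
      = 3 ^+ #|[set i | t \in B i]%SET| :> R.
    under eq_bigr do rewrite ind.
    rewrite -expand (bigID (fun i => t \in B i))/= [X in _ * X]big1 ?mulr1; last first.
      by move=> i /negPf tB; rewrite indicE tB mulr0 addr0.
    rewrite -prodr_const; apply: eq_big => [i|i tB]; first by rewrite inE.
    by rewrite indicE tB mulr1; lra.
  have intZ (a : R) C : 0 <= a -> measurable C ->
      (\int[P]_t (a * \1_C t)%:E = a%:E * P C)%E.
    move=> a0 mC; under eq_integral do rewrite EFinM.
    rewrite ge0_integralZl//; last exact/measurable_EFinP.
    by rewrite integral_indic// setIT.
  have mBJ (J : {set 'I_k}) : measurable (\bigcap_(i in [set` J]) B i).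
    by apply: fin_bigcap_measurable => // i _; exact: mB.
  (* Markov's inequality: the sum equals 3 to the number of events that occur, which on [A] is at
     least [c ^+ k]. *)
  apply: (@le_trans _ _ (\int[P]_t \sum_(J : {set 'I_k})
      (2 ^+ #|J| * \1_(\bigcap_(i in [set` J]) B i) t)%:E)%E).
    rewrite -intZ//; last by rewrite exprn_ge0// ltW.
    apply: ge0_le_integral => //=.
    - by move=> t _; rewrite lee_fin mulr_ge0// exprn_ge0// ltW.
    - by apply/measurable_EFinP; apply: measurable_funM.
    - by apply: emeasurable_sum => J; apply/measurable_EFinP; apply: measurable_funM.
    - move=> t _; rewrite sumEFin sumE lee_fin indicE.
      have [/set_mem tA|_] := boolP (t \in A); last by rewrite mulr0 exprn_ge0.
      by rewrite mulr1 -cc -exprM mulnC muln2 ler_weXn2l.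
  rewrite ge0_integral_sum//;
    last by move=> J; apply/measurable_EFinP; apply: measurable_funM.
  have PBfin i : P (B i) = (fine (P (B i)))%:E by rewrite fineK// fin_num_measure.
  (* Independence makes each term a product of probabilities, so the expansion can be folded
     back. *)
  have -> : (\sum_(J : {set 'I_k})
      \int[P]_t (2 ^+ #|J| * \1_(\bigcap_(i in [set` J]) B i) t)%:E =
      (\prod_i (1 + 2 * fine (P (B i))))%:E)%E.
    rewrite expand -sumEFin; apply: eq_bigr => J _.
    rewrite intZ// ?exprn_ge0// indB EFinM -prodEFin.
    by congr (_ * _)%E; apply: eq_bigr.
  rewrite lee_fin -[X in _ ^+ X](card_ord k) -prodr_const.
  apply: ler_prod => i _; have := PB i; rewrite PBfin lee_fin => PBi.
  by have := @fine_ge0 _ (P (B i)) (measure_ge0 P _); rewrite /=; lra.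
apply: le_trans (_ : ((c / 2) ^+ k)%:E <= _)%E; last by rewrite lee_fin expR_chernoff.
have PAfin : P A = (fine (P A))%:E by rewrite fineK// fin_num_measure.
move: H; rewrite -/A PAfin -EFinM !lee_fin mulrC -ler_pdivlMr ?exprn_gt0//.
have -> : c / 2 = 3 / 2 / c by rewrite -cc; field; rewrite gt_eqF.
by rewrite -expr_div_n.
Qed.
End majority.

Lemma count_map_enum {I : finType} {A : Type} (p : pred A) (Y : I -> A) :
  count p [seq Y i | i <- enum I] = #|[set i | p (Y i)]%SET|.
Proof.
by rewrite cardsE cardE {2}/enum_mem size_filter count_map -enumT; exact: eq_count.
Qed.

(** The [j]-th smallest value is below [x] exactly when more than [j] of the variables are, which is
    a counting event; open lower rays generate the Borel sets. *)
Lemma measurable_order_statistic {d : measure_display} {T : measurableType d}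
    {R : realType} (k : nat) (Y : 'I_k -> T -> R) (j : nat) :
  (forall i, measurable_fun [set: T] (Y i)) -> (j < k)%N ->
  measurable_fun [set: T] (fun t => (sort <=%R [seq Y i t | i <- enum 'I_k])`_j).
Proof.
move=> mY jk; apply: (measurability _ (RGenInftyO.measurableE R)).
move=> _ [_ [x ->] <-]; rewrite setTI.
pose B i := [set t | Y i t < x].
have mB i : measurable (B i).
  by rewrite -[B i]setTI /B -preimage_itvNyo; exact: mY.
rewrite (_ : _ @^-1` _ = [set t | (j < #|[set i | t \in B i]%SET|)%N]).
  exact: measurable_card_ge.
apply/funext => t /=; congr is_true; rewrite in_itv/=.
rewrite (@nth_sort_count _ (fun y => y < x)).
- rewrite count_map_enum; congr (_ < _)%N; apply: eq_card => i.
  by rewrite !inE; apply/idP/idP => [/mem_set|/set_mem].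
- by move=> y z; exact: le_lt_trans.
- by rewrite size_map size_enum_ord.
Qed.

Lemma measurable_median {d : measure_display} {T : measurableType d}
    {R : realType} (k : nat) (Y : 'I_k -> T -> R) :
  (forall i, measurable_fun [set: T] (Y i)) -> (0 < k)%N ->
  measurable_fun [set: T] (fun t => median [seq Y i t | i <- enum 'I_k]).
Proof.
move=> mY k0; rewrite /median.
have sz t : size [seq Y i t | i <- enum 'I_k] = k by rewrite size_map size_enum_ord.
under eq_fun do rewrite sz.
have hk : (k./2 < k)%N by lia.
apply: measurable_funM => //; apply: measurable_funD;
  by apply: measurable_order_statistic => //; lia.
Qed.

(** * Rows of the sketch *)

Lemma measurable_hash_eval {R : realType} {d w : nat} (x : 'rV[R]_d)
    (j : 'I_w.+1) : measurable [set h : hash_fun R d w | h x = j].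
Proof. by apply: sub_sigma_algebra; exists x, j. Qed.

(** A collision is no generator of the sigma-algebra, but a finite union over the common bucket of
    intersections of generators. *)
Lemma measurable_collision {R : realType} {d w : nat} (x y : 'rV[R]_d) :
  measurable [set h : hash_fun R d w | h x = h y].
Proof.
rewrite (_ : mkset _ = \bigcup_(j in [set: 'I_w.+1])
    ([set h : hash_fun R d w | h x = j] `&` [set h | h y = j])).
  apply: fin_bigcup_measurable => // j _.
  by apply: measurableI; exact: measurable_hash_eval.
by apply/seteqP; split => [h /= hxy|h [j _ [/= -> ->]]//]; exists (h y).
Qed.

(** The counter that the query reads in one row, isolated as a function of that row's hash function
    and noise only. *)
Definition row_value {R : realType} {d w : nat} (D : seq 'rV[R]_d)
    (q : 'rV[R]_d) (h : hash_fun R d w) (z : 'I_w.+1 -> R) : R :=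
  (count (fun x => h x == h q) D)%:R + z (h q).

(** The noise is read at a random bucket. Summing over fixed buckets turns it into products of a
    hash indicator and one noise variable, to which measurability and independence apply. *)
Lemma row_valueE {R : realType} {d w : nat} (D : seq 'rV[R]_d)
    (q : 'rV[R]_d) (h : hash_fun R d w) (z : 'I_w.+1 -> R) :
  row_value D q h z = \sum_(x <- D) \1_[set h : hash_fun R d w | h x = h q] h +
    \sum_j \1_[set h : hash_fun R d w | h q = j] h * z j.
Proof.
rewrite /row_value; congr (_ + _).
  rewrite -sum1_count natr_sum big_mkcond/=; apply: eq_bigr => x _.
  rewrite indicE; case: eqP => [hx|hx]; first by rewrite mem_set.
  by rewrite memNset.
rewrite (bigD1 (h q))//= indicE mem_set// mul1r big1 ?addr0// => j jq.
by rewrite indicE memNset ?mul0r//= => hq; rewrite hq eqxx in jq.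
Qed.

Lemma measurable_row_value {R : realType} {d w : nat} (D : seq 'rV[R]_d)
    (q : 'rV[R]_d) {disp : measure_display} {T : measurableType disp}
    (h : T -> hash_fun R d w) (z : 'I_w.+1 -> T -> R) :
  measurable_fun [set: T] h -> (forall j, measurable_fun [set: T] (z j)) ->
  measurable_fun [set: T] (fun t => row_value D q (h t) (z ^~ t)).
Proof.
move=> mh mz; under eq_fun do rewrite row_valueE.
apply: measurable_funD; apply: measurable_sum.
  move=> x; apply: (measurableT_comp _ mh); apply: measurable_indic.
  exact: measurable_collision.
move=> j; apply: measurable_funM => //.
apply: (measurableT_comp _ mh); apply: measurable_indic.
exact: measurable_hash_eval.
Qed.

Lemma sigma_of_measurable {d d' : measure_display} {T : measurableType d}
    {T' : measurableType d'} (X : T -> T') :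
  measurable_fun [set: T] X -> sigma_of X `<=` measurable.
Proof. by move=> mX _ [B mB <-]; exact: mX. Qed.

Lemma sigma_of_setI_closed {d d' : measure_display} {T : measurableType d}
    {T' : measurableType d'} (X : T -> T') : setI_closed (sigma_of X).
Proof.
move=> _ _ [A mA <-] [B mB <-]; exists (A `&` B); first exact: measurableI.
by rewrite !setTI preimage_setI.
Qed.

Lemma sigma_of_preimage {d d' : measure_display} {T : measurableType d}
    {T' : measurableType d'} (X : T -> T') (B : set T') :
  measurable B -> sigma_of X (X @^-1` B).
Proof. by move=> mB; exists B => //; rewrite setTI. Qed.

Lemma sigma_ofT {d d' : measure_display} {T : measurableType d}
    {T' : measurableType d'} (X : T -> T') : sigma_of X [set: T].
Proof. by rewrite -(preimage_setT X); exact: sigma_of_preimage. Qed.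

(** * Square-integrable random variables and their sums *)

Lemma Lfun_indic {d : measure_display} {T : measurableType d} {R : realType}
    (P : probability T R) (A : set T) :
  measurable A -> (\1_A : T -> R) \in Lfun P 2%:E.
Proof.
move=> mA; apply: Lfun2_sqr_lty => //.
under eq_integral => t _.
  rewrite (_ : \1_A t ^+ 2 = \1_A t); last first.
    by rewrite indicE; case: (_ \in _); rewrite ?expr1n// expr0n.
  over.
by rewrite integral_indic// setIT ltey_eq fin_num_measure.
Qed.

Lemma Lfun2_le {d : measure_display} {T : measurableType d} {R : realType}
    (P : probability T R) (X Y : T -> R) :
  measurable_fun [set: T] X -> Y \in Lfun P 2%:E ->
  (forall t, `|X t| <= `|Y t|) -> X \in Lfun P 2%:E.
Proof.
move=> mX /[dup] YL /Lfun2_integrable_sqr/integrableP[mY Yoo] XY.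
apply: Lfun2_sqr_lty => //; apply: le_lt_trans Yoo.
apply: ge0_le_integral => //=.
- by move=> t _; rewrite lee_fin sqr_ge0.
- by apply/measurable_EFinP; exact: measurable_funX.
- exact: (measurableT_comp (@abse_measurable _ _) mY).
- move=> t _; rewrite lee_fin ger0_norm ?sqr_ge0// -[X t ^+ 2]real_normK ?num_real//.
  by rewrite -[Y t ^+ 2]real_normK ?num_real// lerXn2r ?nnegrE.
Qed.

Lemma Lfun21 {d : measure_display} {T : measurableType d} {R : realType}
    (P : probability T R) (X : T -> R) : X \in Lfun P 2%:E -> X \in Lfun P 1.
Proof. by apply: Lfun_subset12; exact: fin_num_measure. Qed.

Lemma Lfun2_sum {d : measure_display} {T : measurableType d} {R : realType}
    (P : probability T R) (I : Type) (X : I -> T -> R) (s : seq I) (p : pred I) :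
  (forall i, X i \in Lfun P 2%:E) -> \sum_(i <- s | p i) X i \in Lfun P 2%:E.
Proof. by move=> XL; rewrite rpred_sum ?lee1n. Qed.

Lemma expectation_bigsum {d : measure_display} {T : measurableType d}
    {R : realType} (P : probability T R) (I : Type) (X : I -> T -> R)
    (s : seq I) : (forall i, X i \in Lfun P 1) ->
  ('E_P[(\sum_(i <- s) X i)%R] = \sum_(i <- s) 'E_P[X i])%E.
Proof.
move=> XL; elim: s => [|i s ih]; first by rewrite !big_nil expectation_cst.
by rewrite !big_cons expectationD ?ih// rpred_sum.
Qed.

Lemma variance_sum_uncorrelated {d : measure_display} {T : measurableType d}
    {R : realType} (P : probability T R) (I : eqType) (X : I -> T -> R)
    (s : seq I) :
  uniq s -> (forall i, X i \in Lfun P 2%:E) ->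
  (forall i j, i != j -> covariance P (X i) (X j) = 0%E) ->
  variance P (\sum_(i <- s) X i) = (\sum_(i <- s) variance P (X i))%E.
Proof.
move=> us XL Xij.
have SL (u : seq I) : \sum_(i <- u) X i \in Lfun P 2%:E.
  exact: Lfun2_sum.
have cov0 i (u : seq I) : i \notin u -> covariance P (X i) (\sum_(j <- u) X j) = 0%E.
  elim: u => [_|j u ih]; first by rewrite big_nil covariance_cst_r.
  rewrite inE negb_or => /andP[ij iu].
  by rewrite big_cons covarianceDr ?ih ?Xij ?adde0// ?Lfun21// ?Lfun2_mul_Lfun1//.
elim: s us => [_|i s ih /= /andP[iu us]]; first by rewrite !big_nil variance_cst.
by rewrite !big_cons varianceD// ih// cov0// mule0 adde0.
Qed.

(** * Mean and variance of one row value *)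

Section row_moments.
Context {R : realType} {d w : nat} (D : seq 'rV[R]_d) (q : 'rV[R]_d).
Context (kappa : 'rV[R]_d -> 'rV[R]_d -> R).
Context {disp : measure_display} {T : measurableType disp} (P : probability T R).
Context (L : {RV P >-> hash_fun R d w}) (Z : 'I_w.+1 -> {RV P >-> R}) (b : R).
Hypothesis b0 : 0 < b.
Hypothesis collisionL : forall x, P [set t | L t x = L t q] = (kappa x q)%:E.
Hypothesis laplaceZ : forall j, laplace_law b (distribution P (Z j)).
Hypothesis indepLZ : forall j A B, measurable A -> measurable B ->
  P (L @^-1` A `&` Z j @^-1` B) = (P (L @^-1` A) * P (Z j @^-1` B))%E.

Let coll (x : 'rV[R]_d) : set T := [set t | L t x = L t q].
Let bucket (j : 'I_w.+1) : set T := [set t | L t q = j].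
Let C : T -> R := \sum_(x <- D) \1_(coll x).
Let W : T -> R := \sum_j (\1_(bucket j) \* Z j).

Let measurable_coll x : measurable (coll x).
Proof.
rewrite -[coll x]setTI.
have mL : measurable_fun [set: T] L by exact: measurable_funPT.
exact: (mL measurableT _ (measurable_collision x q)).
Qed.

Let measurable_bucket j : measurable (bucket j).
Proof.
rewrite -[bucket j]setTI.
have mL : measurable_fun [set: T] L by exact: measurable_funPT.
exact: (mL measurableT _ (measurable_hash_eval q j)).
Qed.

Lemma kappa_ge0 x : 0 <= kappa x q.
Proof. by rewrite -lee_fin -collisionL. Qed.

Lemma row_value_decomp : (fun t => row_value D q (L t) (fun j => Z j t)) = C \+ W.
Proof.
apply/funext => t; rewrite row_valueE /C /W /=; congr (_ + _).
  by rewrite fct_sumE; apply: eq_bigr => x _; rewrite !indicE; congr (_%:R).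
by rewrite fct_sumE; apply: eq_bigr => x _; rewrite /= !indicE; congr (_%:R * _).
Qed.

Let CL : C \in Lfun P 2%:E.
Proof. by apply: Lfun2_sum => x; exact: Lfun_indic. Qed.

Let ZL j : (Z j : T -> R) \in Lfun P 2%:E.
Proof. exact: (laplace_Lfun2 P (Z j) b b0). Qed.

Let bucketZL j : \1_(bucket j) \* Z j \in Lfun P 2%:E.
Proof.
apply: (@Lfun2_le _ _ _ _ _ (Z j)) => //; first exact: measurable_funM.
by move=> t /=; rewrite normrM indicE; case: (_ \in _); rewrite ?normr1 ?mul1r ?normr0 ?mul0r.
Qed.

Let WL : W \in Lfun P 2%:E.
Proof. exact: Lfun2_sum. Qed.

Let indep_fun (g : hash_fun R d w -> R) (u : R -> R) j :
  measurable_fun [set: hash_fun R d w] g -> measurable_fun [set: R] u ->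
  g \o L \in Lfun P 1 -> u \o Z j \in Lfun P 1 ->
  (g \o L) \* (u \o Z j) \in Lfun P 1 /\
  ('E_P[(g \o L) \* (u \o Z j)] = 'E_P[g \o L] * 'E_P[u \o Z j])%E.
Proof.
move=> mg mu gL uZ; apply: expectation_indep_prod => // A B mA mB.
have mgA : measurable (g @^-1` A) by rewrite -[X in measurable X]setTI; exact: mg.
have muB : measurable (u @^-1` B) by rewrite -[X in measurable X]setTI; exact: mu.
exact: (indepLZ j _ _ mgA muB).
Qed.

Let expectation_count : ('E_P[C] = (\sum_(x <- D) kappa x q)%:E)%E.
Proof.
rewrite expectation_bigsum; last by move=> x; exact/Lfun21/Lfun_indic.
by rewrite -sumEFin; apply: eq_bigr => x _; rewrite expectation_indic// collisionL.
Qed.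

Let expectation_count_sqr :
  ('E_P[C \* C] <= ((\sum_(x <- D) Num.sqrt (kappa x q)) ^+ 2)%:E)%E.
Proof.
(* The squared count is a sum over ordered pairs of points that both collide with the query. *)
rewrite [C \* C](_ : _ = \sum_(x <- D) \sum_(y <- D) \1_(coll x `&` coll y)); last first.
  apply/funext => t; rewrite /C /= !fct_sumE mulr_suml; apply: eq_bigr => x _.
  rewrite mulr_sumr fct_sumE; apply: eq_bigr => y _.
  by rewrite -[RHS]/(\1_(coll x `&` coll y) t) indicI.
have mI x y : measurable (coll x `&` coll y) by exact: measurableI.
have IL x y : (\1_(coll x `&` coll y) : T -> R) \in Lfun P 1.
  exact/Lfun21/Lfun_indic.
rewrite expectation_bigsum; last first.
  by move=> x; apply/Lfun21/Lfun2_sum => y; exact: Lfun_indic.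
rewrite expr2 mulr_suml -sumEFin; apply: lee_sum => x _.
rewrite expectation_bigsum// mulr_sumr -sumEFin; apply: lee_sum => y _.
rewrite expectation_indic//.
(* a joint collision has probability at most the smaller marginal, hence at
   most the geometric mean of the two marginals *)
have Px : (P (coll x `&` coll y) <= (kappa x q)%:E)%E.
  by rewrite -collisionL -/(coll x) le_measure ?inE//; exact: subIsetl.
have Py : (P (coll x `&` coll y) <= (kappa y q)%:E)%E.
  by rewrite -collisionL -/(coll y) le_measure ?inE//; exact: subIsetr.
have Pfin : P (coll x `&` coll y) = (fine (P (coll x `&` coll y)))%:E.
  by rewrite fineK// fin_num_measure.
move: Px Py; rewrite Pfin !lee_fin; move: (fine _) => p px py.
have [p0|p0] := leP p 0; first by rewrite (le_trans p0)// mulr_ge0// sqrtr_ge0.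
rewrite -(sqr_sqrtr (ltW p0)) expr2.
by apply: ler_pM; rewrite ?sqrtr_ge0// ler_sqrt// kappa_ge0.
Qed.

Let expectation_funZ (g : hash_fun R d w -> R) j :
  measurable_fun [set: hash_fun R d w] g -> g \o L \in Lfun P 1 ->
  ('E_P[(g \o L) \* Z j] = 0)%E.
Proof.
move=> mg gL.
have [_ E] := indep_fun g idfun j mg (@measurable_id _ _ _) gL (Lfun21 _ _ (ZL j)).
by rewrite -[Z j : T -> R]/(idfun \o Z j) E (laplace_expectation P (Z j) b b0)// mule0.
Qed.

Let indic_bucketE j : \1_(bucket j) = \1_[set h : hash_fun R d w | h q = j] \o L :> (T -> R).
Proof. by apply/funext => t; rewrite /= !indicE; congr (_%:R). Qed.

Let expectation_noise : ('E_P[W] = 0)%E.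
Proof.
rewrite expectation_bigsum; last by move=> j; exact: Lfun21.
rewrite big1// => j _; rewrite indic_bucketE expectation_funZ//.
  by apply: measurable_indic; exact: measurable_hash_eval.
by rewrite -indic_bucketE; exact/Lfun21/Lfun_indic.
Qed.

Let noiseE t : W t = Z (L t q) t.
Proof.
rewrite /W fct_sumE (bigD1 (L t q))//= indicE mem_set// mul1r big1 ?addr0// => j jq.
by rewrite indicE memNset ?mul0r//= => hq; rewrite hq eqxx in jq.
Qed.

(** Count and noise both depend on the bucket hit. Restricted to a fixed bucket [j], the count is
    the function [g j] of the hash alone, hence independent of the centred [Z j]. *)
Let expectation_count_noise : ('E_P[C \* W] = 0)%E.
Proof.
pose g j (h : hash_fun R d w) : R := \sum_(x <- D)
  \1_([set h : hash_fun R d w | h x = h q] `&` [set h | h q = j]) h.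
have gE j : g j \o L = \sum_(x <- D) \1_(coll x `&` bucket j).
  apply/funext => t; rewrite /g /= fct_sumE; apply: eq_bigr => x _.
  by rewrite !indicE; congr (_%:R).
have gL j : g j \o L \in Lfun P 1.
  by rewrite gE; apply/Lfun21/Lfun2_sum => x; apply: Lfun_indic; exact: measurableI.
have mg j : measurable_fun setT (g j).
  apply: measurable_sum => x; apply: measurable_indic; apply: measurableI.
    exact: measurable_collision.
  exact: measurable_hash_eval.
have -> : C \* W = \sum_j ((g j \o L) \* Z j).
  apply/funext => t; rewrite /C /W /= !fct_sumE mulr_sumr; apply: eq_bigr => j _.
  rewrite gE /= fct_sumE !mulr_suml; apply: eq_bigr => x _.
  by rewrite indicI /= mulrA.
rewrite expectation_bigsum; first by rewrite big1// => j _; exact: expectation_funZ.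
move=> j; have [] := indep_fun (g j) idfun j (mg j) (@measurable_id _ _ _) (gL j) (Lfun21 _ _ (ZL j)).
by [].
Qed.

(** Exactly one bucket is hit at each outcome, so squaring creates no cross terms. Each bucket
    contributes its probability times [2 * b ^+ 2], and these probabilities add up to 1. *)
Let expectation_noise_sqr : ('E_P[W \* W] = (2 * b ^+ 2)%:E)%E.
Proof.
pose sqr (x : R) := x ^+ 2.
have msqr : measurable_fun setT sqr by exact: exprn_measurable.
have sqrL j : sqr \o Z j \in Lfun P 1.
  by apply/Lfun1_integrable; exact: Lfun2_integrable_sqr.
have bL j : \1_[set h : hash_fun R d w | h q = j] \o L \in Lfun P 1.
  by rewrite -indic_bucketE; exact/Lfun21/Lfun_indic.
have mb j : measurable_fun setT (\1_[set h : hash_fun R d w | h q = j] : _ -> R).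
  by apply: measurable_indic; exact: measurable_hash_eval.
have H j := indep_fun _ _ j (mb j) msqr (bL j) (sqrL j).
have -> : W \* W = \sum_j ((\1_[set h : hash_fun R d w | h q = j] \o L) \* (sqr \o Z j)).
  apply/funext => t; rewrite /= noiseE fct_sumE (bigD1 (L t q))//=.
  rewrite indicE mem_set// mul1r big1 ?addr0// => j jq.
  by rewrite indicE memNset ?mul0r//= => hq; rewrite hq eqxx in jq.
rewrite expectation_bigsum; last by move=> j; have [] := H j.
transitivity (\sum_j ('E_P[\1_(bucket j)] * (2 * b ^+ 2)%:E))%E.
  apply: eq_bigr => j _; rewrite (H j).2 -indic_bucketE; congr (_ * _)%E.
  by rewrite unlock; exact: (laplace_expectation_sqr P (Z j) b b0).
rewrite -ge0_sume_distrl; last by move=> j _; apply: expectation_ge0 => t.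
rewrite -expectation_bigsum; last by move=> j; exact/Lfun21/Lfun_indic.
rewrite [X in ('E_P[X])%E](_ : _ = cst 1) ?expectation_cst ?mul1e//.
apply/funext => t; rewrite fct_sumE (bigD1 (L t q))//= indicE mem_set// big1 ?addr0// => j jq.
by rewrite indicE memNset//= => hq; rewrite hq eqxx in jq.
Qed.

Let X t := row_value D q (L t) (fun j => Z j t).

Lemma row_value_Lfun2 : X \in Lfun P 2%:E.
Proof. by rewrite /X row_value_decomp rpredD ?lee1n. Qed.

Lemma expectation_row_value : ('E_P[X] = (\sum_(x <- D) kappa x q)%:E)%E.
Proof.
by rewrite /X row_value_decomp expectationD ?Lfun21// expectation_count expectation_noise adde0.
Qed.

Lemma variance_row_value :
  (variance P X <=
   ((\sum_(x <- D) Num.sqrt (kappa x q)) ^+ 2 + 2 * b ^+ 2)%:E)%E.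
Proof.
have CC := Lfun2_mul_Lfun1 CL CL; have WW := Lfun2_mul_Lfun1 WL WL.
have CW := Lfun2_mul_Lfun1 CL WL.
rewrite varianceE ?row_value_Lfun2//.
(* The squared mean is dropped: the second moment already satisfies the bound. *)
apply: (@le_trans _ _ ('E_P[X ^+ 2])%E).
  by rewrite expectation_row_value leeBlDr// leeDl// -EFin_expe lee_fin sqr_ge0.
rewrite [X ^+ 2](_ : _ = (C \* C \+ C \* W) \+ (C \* W \+ W \* W)); last first.
  rewrite {1}/X row_value_decomp; apply/funext => t; rewrite expr2 /=.
  by rewrite -[LHS]/((C t + W t) * (C t + W t)); ring.
rewrite expectationD ?rpredD// !expectationD// expectation_count_noise expectation_noise_sqr.
by rewrite adde0 add0e EFinD leeD2r.
Qed.

End row_moments.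

(** * Group means and the median-of-means estimate *)

Section block_mean.
Context {d : measure_display} {T : measurableType d} {R : realType}.
Context (P : probability T R) (I : finType) (X : I -> T -> R) (A : {set I}).
Context (f v t : R).
Hypothesis XL : forall i, X i \in Lfun P 2%:E.
Hypothesis EX : forall i, 'E_P[X i]%E = f%:E.
Hypothesis VX : forall i, (variance P (X i) <= v%:E)%E.
Hypothesis uncorrelated : forall i j, i != j -> covariance P (X i) (X j) = 0%E.

(** Uncorrelated terms give the mean a variance of at most [v / #|A|], which is a quarter of
    [t ^+ 2]; Chebyshev's inequality concludes. *)
Lemma block_mean_tail : (0 < #|A|)%N -> 0 < t -> t ^+ 2 = 4 * v / #|A|%:R ->
  (P [set s | t <= `|(\sum_(i in A) X i s) / #|A|%:R - f|]%R <= (1 / 4)%:E)%E.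
Proof.
move=> A0 t0 tE; have m0 : 0 < #|A|%:R :> R by rewrite ltr0n.
pose S : T -> R := \sum_(i <- enum A) X i.
pose Y : T -> R := #|A|%:R^-1 \o* S.
have SL : S \in Lfun P 2%:E by exact: Lfun2_sum.
have YL : Y \in Lfun P 2%:E by rewrite Lfun_scale// ler1n.
have mY : measurable_fun setT Y by move: YL; rewrite inE => /andP[]; rewrite inE.
have ES : ('E_P[S] = (#|A|%:R * f)%:E)%E.
  rewrite expectation_bigsum; last by move=> i; exact: Lfun21.
  under eq_bigr do rewrite EX.
  by rewrite sumEFin big_const_seq count_predT -cardE iter_addr_0 mulr_natl.
have EY : ('E_P[Y] = f%:E)%E.
  by rewrite expectationZl ?Lfun21// ES -EFinM mulKf// gt_eqF.
have VY : (variance P Y <= (v / #|A|%:R)%:E)%E.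
  rewrite varianceZ// variance_sum_uncorrelated ?enum_uniq//.
  apply: (@le_trans _ _ ((#|A|%:R^-1 ^+ 2)%:E * (#|A|%:R * v)%:E)%E).
    rewrite lee_pmul2l ?lte_fin ?exprn_gt0 ?invr_gt0//.
    apply: (@le_trans _ _ (\sum_(i <- enum A) v%:E)%E); first by apply: lee_sum.
    by rewrite sumEFin big_const_seq count_predT -cardE iter_addr_0 mulr_natl.
  by rewrite -EFinM lee_fin le_eqVlt; apply/orP; left; apply/eqP; field; rewrite gt_eqF.
pose Y' : {RV P >-> R} := mfun_Sub (mem_set mY).
have := chebyshev Y' t0; rewrite /= EY /= => cheb.
rewrite [X in P X](_ : _ = [set x | t <= `|Y x - f|]).
  apply: (le_trans cheb); apply: (@le_trans _ _ ((t ^- 2)%:E * (v / #|A|%:R)%:E)%E).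
    by rewrite lee_pmul2l// lte_fin invr_gt0 exprn_gt0.
  rewrite -EFinM lee_fin tE.
  (* Needed to cancel [v] in the quotient; it follows from [0 < t ^+ 2]. *)
  have v0 : v != 0.
    have : 0 < t ^+ 2 by rewrite exprn_gt0.
    by rewrite tE; apply: contraTneq => ->; rewrite mulr0 mul0r ltxx.
  by rewrite le_eqVlt; apply/orP; left; apply/eqP; field; rewrite v0 gt_eqF.
by apply/seteqP; split => x /=; rewrite /Y /S /= fct_sumE -big_enum/= mulrC.
Qed.

End block_mean.

(** The quotient by [m] is [i] exactly on the [m] consecutive indices from [i * m], and [i < k]
    keeps them all below [k * m]. *)
Lemma big_block {V : Type} {idx : V} (op : Monoid.com_law idx) (k m i : nat)
    (F : nat -> V) : (0 < m)%N -> (i < k)%N ->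
  \big[op/idx]_(r < k * m | (r %/ m == i)%N) F r =
  \big[op/idx]_(j <- iota (i * m) m) F j.
Proof.
move=> m0 ik; rewrite -(big_mkord (fun r => r %/ m == i)%N F) -big_filter.
apply: perm_big; apply: uniq_perm; rewrite ?filter_uniq ?iota_uniq// => j.
rewrite mem_filter !mem_iota add0n subn0 eqn_leq -ltnS ltn_divLR// leq_divRL//.
rewrite mulSn; have : (i.+1 * m <= k * m)%N by rewrite leq_mul2r ik orbT.
by rewrite mulSn; lia.
Qed.

Lemma race_estimateE {R : realType} {d w : nat} (D : seq 'rV[R]_d)
    (q : 'rV[R]_d) (k m : nat) (l : 'I_(k * m) -> hash_fun R d w)
    (z : 'I_(k * m) -> 'I_w.+1 -> R) : (0 < m)%N ->
  race_estimate k m l (private_race_sketch l z D) q =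
  median [seq (\sum_(r < k * m | (r %/ m == i)%N) row_value D q (l r) (z r)) / m%:R
    | i : 'I_k <- enum 'I_k].
Proof.
move=> m0; rewrite /race_estimate /median_of_means; congr median.
set s := [seq _ | r <- enum 'I_(k * m)].
have ss : size s = (k * m)%N by rewrite size_map size_enum_ord.
have sE (r : 'I_(k * m)) : s`_r = row_value D q (l r) (z r).
  by rewrite (nth_map r) ?size_enum_ord// nth_ord_enum !mxE.
rewrite (reshape_nseqE 0 _ _ _ ss) -map_comp -val_enum_ord -map_comp.
apply: eq_map => i /=; rewrite /mean size_map size_iota big_map.
by rewrite -(@big_block _ _ _ k)//; congr (_ / _); apply: eq_bigr => r _; rewrite sE.
Qed.

Lemma covariance_indep {d : measure_display} {T : measurableType d}
    {R : realType} (P : probability T R) (U V : T -> R) :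
  U \in Lfun P 1 -> V \in Lfun P 1 ->
  (forall A B, measurable A -> measurable B ->
    P (U @^-1` A `&` V @^-1` B) = (P (U @^-1` A) * P (V @^-1` B))%E) ->
  covariance P U V = 0%E.
Proof.
move=> UL VL indUV; have [UVL UVE] := expectation_indep_prod _ _ _ UL VL indUV.
rewrite covarianceE//; rewrite -[(U * V)%R]/(U \* V) UVE subee//.
by rewrite fin_numM// expectation_fin_num.
Qed.

(** Measurability for the sigma-algebra of a block, rather than for the ambient one, records that a
    variable depends on that block only. *)
Lemma measurable_block {d d' : measure_display} {T : measurableType d}
    {T' : measurableType d'} (I K : finType) (f : I -> K)
    (G : I -> set (set T)) (i : I) (V : T -> T') :
  (forall j, G j setT) -> G i = sigma_of V ->
  measurable_fun [set: g_sigma_algebraType (block_system I K f G (f i))] V.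
Proof.
move=> GT GV _ B mB; apply: sub_sigma_algebra; apply: sub_block_system => //.
by rewrite GV setTI; exact: sigma_of_preimage.
Qed.

Theorem theorem4 (R : realType) (d w N n : nat)
    (D : N.-tuple 'rV[R]_d) (eps delta : R)
    (heps : 0 < eps) (hdelta : 0 < delta < 1)
    (F : hash_family R d w) (kappa : 'rV[R]_d -> 'rV[R]_d -> R)
    (hF : locality_sensitive F kappa)
    (disp : measure_display) (Omega : measurableType disp)
    (P : probability Omega R)
    (l : 'I_n -> {RV P >-> hash_fun R d w})
    (Z : 'I_n -> 'I_w.+1 -> {RV P >-> R})
    (hl_mem : forall r omega, hash_members F (l r omega))
    (hl_law : forall r A, measurable A ->
       distribution P (l r) A = hash_draw F A)
    (hZ_law : forall r j, laplace_law (n%:R / eps) (distribution P (Z r j)))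
    (hindep : mutually_independent P
       (fun i : 'I_n + 'I_n * 'I_w.+1 =>
          match i with
          | inl r => sigma_of (l r)
          | inr (r, j) => sigma_of (Z r j)
          end))
    (k m : nat) (hn : (0 < n)%N)
    (hk : k%:R = 8 * ln (1 / delta)) (hm : n = (k * m)%N)
    (q : 'rV[R]_d) :
  let S omega :=
    private_race_sketch (fun r => l r omega) (fun r j => Z r j omega) D in
  let fhat omega := race_estimate k m (fun r => l r omega) (S omega) q in
  let f := \sum_(x <- D) kappa x q in
  let ftilde := \sum_(x <- D) Num.sqrt (kappa x q) in
  (((1 - delta)%:E <=
     P [set omega | `|fhat omega - f| <=
          Num.sqrt (ftilde ^+ 2 / n%:R + 2 / eps ^+ 2 * n%:R)
          * Num.sqrt (32 * ln (1 / delta))]%R)%E : Prop).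
Proof.
move=> S fhat f ftilde; subst n.
have k0 : (0 < k)%N by move: hn; rewrite muln_gt0 => /andP[].
have m0 : (0 < m)%N by move: hn; rewrite muln_gt0 => /andP[].
set n := (k * m)%N in l Z hl_mem hl_law hZ_law hindep hn S fhat *.
have n0 : 0 < n%:R :> R by rewrite ltr0n.
pose b : R := n%:R / eps; have b0 : 0 < b by rewrite divr_gt0.
pose v := ftilde ^+ 2 + 2 * b ^+ 2.
have v0 : 0 < v by rewrite ltr_wpDl ?sqr_ge0// mulr_gt0// exprn_gt0.
set t := Num.sqrt _ * Num.sqrt _.
(* The constant 32 is 4 times the 8 in [k]: [32 * ln (1 / delta) = 4 * k], and [n = k * m] leaves
   what Chebyshev's inequality needs for tail 1/4. *)
have tE : t ^+ 2 = 4 * v / m%:R.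
  rewrite exprMn !sqr_sqrtr.
  - rewrite /v /b (_ : 32 * ln (1 / delta) = 4 * k%:R); last by rewrite hk; ring.
    by rewrite natrM; field; rewrite !gt_eqF ?ltr0n.
  - by rewrite (_ : 32 * ln (1 / delta) = 4 * k%:R) ?mulr_ge0// hk; ring.
  - apply: addr_ge0; first by rewrite divr_ge0 ?sqr_ge0.
    by rewrite mulr_ge0// divr_ge0// exprn_ge0// ltW.
have t0 : 0 < t.
  have t0 : 0 <= t by rewrite mulr_ge0 ?sqrtr_ge0.
  rewrite lt_neqAle t0 andbT eq_sym -sqrf_eq0 tE.
  by rewrite gt_eqF// divr_gt0 ?mulr_gt0 ?ltr0n.
set G := (fun i : 'I_n + 'I_n * 'I_w.+1 => _) in hindep.
have GI i : setI_closed (G i).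
  by case: i => [r|[r j]]; exact: sigma_of_setI_closed.
have mG i : G i `<=` measurable.
  by case: i => [r|[r j]]; apply: sigma_of_measurable; exact: measurable_funPT.
have GT i : G i setT by case: i => [r|[r j]]; exact: sigma_ofT.
pose X r omega := row_value D q (l r omega) (fun j => Z r j omega).
(* Sends each source of randomness to its row. Composed with the identity it gives rows as blocks,
   and with [grp] groups of rows. *)
pose rowof (i : 'I_n + 'I_n * 'I_w.+1) : 'I_n :=
  match i with inl r => r | inr (r, _) => r end.
have mX (K : finType) (g : 'I_n -> K) r :
    measurable_fun [set: g_sigma_algebraType
      (block_system _ K (g \o rowof) G (g r))] (X r).
  apply: measurable_row_value.
    exact: (measurable_block _ K (g \o rowof) G (inl r) (l r)).
  by move=> j; exact: (measurable_block _ K (g \o rowof) G (inr (r, j)) (Z r j)).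
have blocks (K : finType) (g : 'I_n -> K) :=
  mutually_independent_blocks P _ K (g \o rowof) G GI mG hindep.
have indepLZ r j A B : measurable A -> measurable B ->
    P (l r @^-1` A `&` Z r j @^-1` B) = (P (l r @^-1` A) * P (Z r j @^-1` B))%E.
  move=> mA mB; apply: (mutually_independent2 _ _ G (inl r) (inr (r, j))) => //;
    exact: sigma_of_preimage.
have collision r x : P [set omega | l r omega x = l r omega q] = (kappa x q)%:E.
  by rewrite -hF -(hl_law r)//; exact: measurable_collision.
have XL r : X r \in Lfun P 2%:E by exact: (row_value_Lfun2 D q P (l r) (Z r) b).
have EX r : ('E_P[X r] = f%:E)%E.
  exact: (expectation_row_value D q kappa P (l r) (Z r) b b0
    (collision r) (hZ_law r) (indepLZ r)).
have VX r : (variance P (X r) <= v%:E)%E.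
  exact: (variance_row_value D q kappa P (l r) (Z r) b b0
    (collision r) (hZ_law r) (indepLZ r)).
(* Blocks that are single rows: distinct rows are independent, hence uncorrelated. *)
have cov r s : r != s -> covariance P (X r) (X s) = 0%E.
  move=> rs; apply: covariance_indep; [exact: Lfun21|exact: Lfun21|] => A B mA mB.
  apply: (mutually_independent2 _ _ _ r s _ _ (blocks _ idfun)) => //.
    by rewrite -[X in _ X]setTI; exact: (mX _ idfun r).
  by rewrite -[X in _ X]setTI; exact: (mX _ idfun s).
have grp_lt (r : 'I_n) : (r %/ m < k)%N by rewrite ltn_divLR.
pose grp r : 'I_k := Ordinal (grp_lt r).
pose A i : {set 'I_n} := [set r | grp r == i]%SET.
have cardA i : #|A i| = m.
  rewrite -sum1_card (eq_bigl (fun r : 'I_n => r %/ m == i)%N); last by move=> r; rewrite inE.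
  by rewrite (big_block _ k m i (fun=> 1%N))// sum1_size size_iota.
pose Y i omega := (\sum_(r in A i) X r omega) / #|A i|%:R.
have fhatE omega : fhat omega = median [seq Y i omega | i <- enum 'I_k].
  rewrite /fhat race_estimateE//; congr median; apply: eq_map => i.
  by rewrite /Y cardA; congr (_ / _); apply: eq_bigl => r; rewrite inE.
pose B i := [set omega | t <= `|Y i omega - f|].
have mYb i : measurable_fun [set: g_sigma_algebraType
    (block_system _ _ (grp \o rowof) G i)] (Y i).
  apply: measurable_funM => //; under eq_fun do rewrite big_mkcond.
  apply: measurable_sum => r; rewrite inE.
  by case: eqP => [<-|_]; [exact: mX|exact: measurable_cst].
(* Each failure event lies in the sigma-algebra of its own group, so these events are
   independent. *)
have Bblock i : <<s block_system _ _ (grp \o rowof) G i >> (B i).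
  have mN : measurable_fun [set: g_sigma_algebraType
      (block_system _ _ (grp \o rowof) G i)] (fun omega => `|Y i omega - f|).
    by apply: measurableT_comp => //; apply: measurable_funB.
  have := mN measurableT _ (measurable_itv `[t, +oo[).
  by rewrite preimage_itvcy setTI.
have mXO r : measurable_fun [set: Omega] (X r).
  by have := XL r; rewrite inE => /andP[]; rewrite inE.
have mYO i : measurable_fun [set: Omega] (Y i).
  apply: measurable_funM => //; under eq_fun do rewrite big_mkcond.
  by apply: measurable_sum => r; case: (r \in A i); [exact: mXO|exact: measurable_cst].
have mB i : measurable (B i).
  rewrite -[B i]setTI /B -preimage_itvcy.
  by apply: measurableT_comp => //; apply: measurable_funB.
have PB i : (P (B i) <= (1 / 4)%:E)%E.
  apply: (block_mean_tail P _ X (A i) f v t XL EX VX cov); rewrite ?cardA//.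
have maj := independent_majority P k B mB _ PB.
have {}maj : (P [set omega | (k <= (#|[set i | omega \in B i]%SET|).*2)%N] <= delta%:E)%E.
  (* The choice of [k] makes the majority bound equal to [delta]. *)
  rewrite (_ : delta = expR (- (k%:R / 8))).
    by apply: maj => J; apply: (blocks _ grp) => i _; exact: Bblock.
  move/andP: hdelta => [delta0 _].
  rewrite hk div1r lnV ?posrE// (_ : - (8 * - ln delta / 8) = ln delta).
    by rewrite lnK ?posrE.
  by field.
have mfhat : measurable_fun [set: Omega] fhat.
  rewrite (_ : fhat = fun omega => median [seq Y i omega | i <- enum 'I_k]).
    exact: measurable_median.
  exact/funext.
set good := [set omega | _].
have mgood : measurable good.
  rewrite -[good]setTI /good -preimage_itvNyc.
  by apply: measurableT_comp => //; apply: measurable_funB.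
(* It remains to bound the complement of [good], which is contained in the majority event. *)
rewrite -[good]setCK probability_setC ?EFinB ?leeB//; last exact: measurableC.
apply: (le_trans _ maj); apply: le_measure; rewrite ?inE.
- exact: measurableC.
- exact: (measurable_majority _ B).
- move=> omega /negP; rewrite -ltNge fhatE => far /=.
  have sz : size [seq Y i omega | i <- enum 'I_k] = k by rewrite size_map size_enum_ord.
  have := median_far_count [seq Y i omega | i <- enum 'I_k] f t.
  rewrite sz count_map_enum => /(_ k0 far).
  congr (_ <= _.*2)%N; apply: eq_card => i; rewrite !inE.
  by apply/idP/idP => [/mem_set|/set_mem].
Qed.
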